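(* Assume that $X[\mathcal{T}]$ is a locally convex topological vector space whose topology is generated by a filtering family of seminorms $\langle\|\cdot\|_i\rangle_{i\in I}$; $|||\cdot|||$ is a seminorm on $X$ that is $\mathcal{T}$-lower-semicontinuous; $\langle X_k\rangle_{k\in\mathbb{N}}$ is a non-decreasing sequence of $\mathcal{T}$-closed linear subspaces whose union is $X$; $C_k=X_k\cap\{u:|||u|||\le k\}$ for each $k\in\mathbb{N}$; $\mathcal{T}|_{C_k}$ is compact for each $k\in\mathbb{N}$; and $\mathcal{C}=\{C_k:k\in\mathbb{N}\}$. Let $\mathcal{F}\subseteq X[\mathcal{T}_{\mathcal{C}}]^*$ be $\beta(X^*,X)$-closed. The following are equivalent. (A) $\mathcal{F}$ is $\beta(X^*,X)$-compact. (B) For every $\varepsilon>0$ there exist $i\in I$ and $\theta>0$ such that for all $x\in X_{\lceil\varepsilon^{-1}\rceil}$ and all $f\in\mathcal{F}$: $|f(x)|\le\theta\cdot\|x\|_i+\varepsilon\cdot|||x|||$.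
   Context: All vector spaces are real; topological vector spaces are Hausdorff. $X[\mathcal{T}]$ denotes $X$ equipped with the topology $\mathcal{T}$; $\mathcal{T}|_C=\{E\cap C:E\in\mathcal{T}\}$. A family of seminorms generates a locally convex topology in the usual way (it is separating, and finite intersections of closed seminorm balls centred at $0$ form a local base); it is filtering if for all $i_1,\dots,i_N\in I$ there is $i\in I$ with $\max_n\|\cdot\|_{i_n}\le\|\cdot\|_i$. A localizing family in $X$ is a non-empty collection $\mathcal{C}$ of convex subsets of $X$ containing $0$ such that for all $C\in\mathcal{C}$, $x\in X$, $t\in\mathbb{R}$ there is $D\in\mathcal{C}$ with $x+t\cdot C\subseteq D$ (the family of the claim is one). The localization $\mathcal{T}_{\mathcal{C}}$ is the locally convex vector topology on $X$ consisting of all $E\subseteq X$ such that for every $x\in E$ there is a convex $V$ with $x\in V\subseteq E$ and $V\cap C\in\mathcal{T}|_C$ for every $C\in\mathcal{C}$. $X[\mathcal{T}_{\mathcal{C}}]^*$ is the space of $\mathcal{T}_{\mathcal{C}}$-continuous linear forms on $X$; $\beta(X^*,X)$ is its strong topology (uniform convergence on $\mathcal{T}_{\mathcal{C}}$-bounded subsets of $X$). *)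

(* Defs.v *)
From HB Require Import structures.
From mathcomp Require Import all_boot all_order all_algebra.
From mathcomp Require Import all_classical all_reals all_analysis.

Set Implicit Arguments.
Unset Strict Implicit.
Unset Printing Implicit Defensive.

Import Order.TTheory GRing.Theory Num.Theory.
Import numFieldNormedType.Exports.

Local Open Scope classical_set_scope.
Local Open Scope ring_scope.

Section seminorms.
Context {R : realType} {X : lmodType R}.

(* Nonnegativity of p follows from these two conditions. *)
Definition is_seminorm (p : X -> R) : Prop :=
  (forall x y, p (x + y) <= p x + p y) /\
  (forall (a : R) x, p (a *: x) = `|a| * p x).

(* The case J = set0 makes a filtering family non-empty. *)
Definition filtering (I : Type) (p : I -> X -> R) : Prop :=
  forall J : set I, finite_set J ->
    exists i, forall j, J j -> forall x, p j x <= p i x.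

End seminorms.

(* In `ir : I * R`, ir.1 is the index of a seminorm and ir.2 a radius. *)
Definition generated_by {R : realType} {X : tvsType R} (I : Type)
    (p : I -> X -> R) : Prop :=
  (forall x, (forall i, p i x = 0) -> x = 0) /\
  (forall U : set X, nbhs 0 U <->
     exists J : set (I * R), [/\ finite_set J,
       forall ir, J ir -> 0 < ir.2 &
       \bigcap_(ir in J) [set x | p ir.1 x <= ir.2] `<=` U]).

(* The type X with the topology T_C, T being the topology of X. T_C is a
   topology for any collection C of subsets of X; it is a vector topology
   when C is a localizing family. *)
Definition localization {R : realType} {X : tvsType R} (C : set (set X)) : Type
  := X.

Section localization_topology.
Context {R : realType} {X : tvsType R} (C : set (set X)).

Definition localized_open (E : set (localization C)) : Prop :=
  forall x : X, E x -> exists V : set X, [/\ convex_set V, V x, V `<=` E &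
    forall A, C A -> exists2 U : set X, open U & V `&` A = U `&` A].

Lemma localized_openT : localized_open setT.
Proof.
by move=> x _; exists setT; split => // A _; exists setT => //; exact: openT.
Qed.

Lemma localized_openI : setI_closed localized_open.
Proof.
move=> E F Eo Fo x [/Eo[V [Vc Vx VE VC]] /Fo[W [Wc Wx WF WC]]].
exists (V `&` W); split => //.
- move=> a b l; rewrite !inE => -[Va Wa] [Vb Wb]; split.
  + by apply/set_mem/Vc; exact/mem_set.
  + by apply/set_mem/Wc; exact/mem_set.
- exact: setISS.
- move=> A CA; have [U Uo VU] := VC A CA; have [U' U'o WU] := WC A CA.
  exists (U `&` U'); first exact: openI.
  by rewrite setIIl VU WU -setIIl.
Qed.

Lemma localized_open_bigcup (J : Type) (E : J -> set (localization C)) :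
  (forall j, localized_open (E j)) -> localized_open (\bigcup_j E j).
Proof.
move=> Eo x [j _ /Eo[V [Vc Vx VE VC]]]; exists V; split => //.
by move=> y /VE Ey; exists j.
Qed.

HB.instance Definition _ := GRing.Lmodule.on (localization C).
HB.instance Definition _ := isOpenTopological.Build (localization C)
  localized_openT localized_openI localized_open_bigcup.

End localization_topology.

Section strong_dual.
Context {R : realType} (E : preTopologicalLmodType R).

(* `bounded_set` of the library is only about normed spaces. *)
Definition vn_bounded (B : set E) : Prop :=
  forall U : set E, nbhs 0 U -> exists2 r : R, 0 < r &
    forall t : R, r < t -> B `<=` [set t *: u | u in U].

Definition continuous_forms : set {family vn_bounded, E -> R} :=
  [set f | scalar (f : E -> R) /\ continuous (f : E -> R)].

(* Continuous linear forms, as a topological subspace of the functions E -> R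
   with the topology of uniform convergence on bounded sets. *)
Definition strong_dual : topologicalType := set_type continuous_forms.

Definition dual_fun (f : strong_dual) : E -> R := set_val f.

End strong_dual.

Definition truncated_ball {R : realType} {X : tvsType R} (Xs : nat -> set X)
    (q : X -> R) (k : nat) : set X :=
  Xs k `&` [set u | q u <= k%:R].

(* Main.v *)
(* (A) => (B): each f in F is T-continuous at 0 on C_k, so the compactness of F
   gives |f| <= 1 on C_k /\ {p_i <= r} for all f in F at once; scaling turns
   this into (B), with theta = 1/r and eps >= 1/k.
   (B) => (A): an ultrafilter on F converges pointwise, by (B) to a linear form
   g that satisfies the same bounds. These bounds make F and g equicontinuous on
   each compact C_k, so that g is T_C-continuous and the convergence is uniform
   on each C_k. That this is convergence in the strong dual amounts to the fact
   that every T_C-bounded set lies in some C_k. *)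
Require Import Defs.
From mathcomp Require Import all_boot all_order all_algebra finmap.
From mathcomp Require Import all_classical all_reals all_analysis.
From mathcomp Require Import ring lra.

Set Implicit Arguments.
Unset Strict Implicit.
Unset Printing Implicit Defensive.

Import Order.TTheory GRing.Theory Num.Theory.
Import numFieldNormedType.Exports.

Local Open Scope classical_set_scope.
Local Open Scope ring_scope.

Lemma convex_comb_lt (R : realFieldType) (t a b r : R) :
  0 <= t -> t <= 1 -> a < r -> b < r -> t * a + (1 - t) * b < r.
Proof. by move=> t0 t1 ar br; have [|] := leP a b => ab; nra. Qed.

Section scalar_form.
Context {R : realType} {X : lmodType R} (f : X -> R).
Hypothesis f_scalar : scalar f.

Lemma scalar_form0 : f 0 = 0.
Proof. by have := f_scalar 1 0 0; rewrite scaler0 addr0; lra. Qed.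

Lemma scalar_formZ a x : f (a *: x) = a * f x.
Proof. by rewrite -[a *: x]addr0 f_scalar scalar_form0 addr0. Qed.

End scalar_form.

Section seminorm.
Context {R : realType} {X : lmodType R} (p : X -> R).
Hypothesis p_seminorm : is_seminorm p.

Lemma seminorm0 : p 0 = 0.
Proof. by rewrite -(scale0r 0) p_seminorm.2 normr0 mul0r. Qed.

Lemma seminormN x : p (- x) = p x.
Proof. by rewrite -scaleN1r p_seminorm.2 normrN1 mul1r. Qed.

Lemma seminormB x y : p (x - y) <= p x + p y.
Proof. by rewrite -(seminormN y) p_seminorm.1. Qed.

Lemma seminorm_ge0 x : 0 <= p x.
Proof. by have := seminormB x x; rewrite subrr seminorm0; lra. Qed.

Lemma seminorm_conv (x y : convex_lmodType X) (t : {i01 R}) :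
  p (conv t x y) <= t%:num * p x + (1 - t%:num) * p y.
Proof.
apply: (le_trans (p_seminorm.1 _ _)); rewrite !p_seminorm.2 !ger0_norm//.
by rewrite subr_ge0.
Qed.

End seminorm.

Section seminorm_topology.
Context {R : realType} {X : tvsType R} {I : Type} {p : I -> X -> R}.
Hypothesis p_generates : generated_by p.

Lemma nbhs0_seminorm_ball i (r : R) : 0 < r -> nbhs 0 [set x | p i x <= r].
Proof.
move=> r0; apply/p_generates.2; exists [set (i, r)]; split => //.
- by move=> _ ->.
- by move=> x /(_ (i, r)); exact.
Qed.

Lemma nbhs_seminorm_ball i (r : R) x :
  0 < r -> \forall y \near x, p i (y - x) <= r.
Proof.
move=> r0; apply: (filterS _ (nbhsT x (nbhs0_seminorm_ball i r0))).
by move=> _ [u pu <-]; rewrite addrAC subrr add0r.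
Qed.

Hypothesis p_filtering : filtering p.

Lemma nbhs0_seminormP (U : set X) :
  nbhs 0 U <-> exists i (r : R), 0 < r /\ [set x | p i x <= r] `<=` U.
Proof.
split=> [/p_generates.2[J [Jfin J0 JU]]|[i [r [r0 rU]]]]; last first.
  exact: filterS rU (nbhs0_seminorm_ball i r0).
have [i iJ] := p_filtering (finite_image fst Jfin).
have [r [r0 rJ]] : exists r : R, 0 < r /\ forall ir, J ir -> r <= ir.2.
  have /finite_fsetP[D JD] := finite_image snd Jfin.
  have : \forall r \near 0^'+, forall s, s \in D -> r <= s.
    suff : 0^'+ (\bigcap_(s in [set` D]) [set r : R | r <= s]).
      by apply: filterS => r rD s sD; exact: rD.
    apply: filter_bigI => s sD /=; apply: nbhs_right_le.
    have [ir Jir <-] : (snd @` J) s by rewrite JD.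
    exact: J0.
  move=> rD; near (0 : R)^'+ => r; exists r; split=> // ir Jir.
  have : forall s, s \in D -> r <= s by near: r.
  apply; suff : [set` D] ir.2 by [].
  by rewrite -JD; exists ir.
exists i, r; split => // x pr; apply: JU => jr Jjr /=.
by rewrite (le_trans _ (rJ _ Jjr))// (le_trans _ pr)// iJ//; exists jr.
Unshelve. all: by end_near. Qed.

Lemma nbhs_seminormP (U : set X) x :
  nbhs x U <-> exists i (r : R), 0 < r /\ forall y, p i (y - x) <= r -> U y.
Proof.
split=> [xU|[i [r [r0 rU]]]]; last first.
  exact: filterS rU (nbhs_seminorm_ball i x r0).
have := nbhsB (- x) xU; rewrite addNr => /nbhs0_seminormP[i [r [r0 rU]]].
exists i, r; split => // y /rU[u Uu]; rewrite addrC => /addIr <-//.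
Qed.

End seminorm_topology.

Section dual.
Context {R : realType} {E : preTopologicalLmodType R}.

Lemma dual_fun_scalar (f : strong_dual E) : scalar (dual_fun f).
Proof. exact: (set_mem (valP f)).1. Qed.

Lemma dual_fun_continuous (f : strong_dual E) : continuous (dual_fun f).
Proof. exact: (set_mem (valP f)).2. Qed.

Lemma strong_dual_nbhs (f : strong_dual E) (B : set E) (e : R) :
  vn_bounded B -> 0 < e ->
  \forall g \near f, forall x, B x -> `|dual_fun f x - dual_fun g x| < e.
Proof.
move=> Bb e0.
pose V := [set fg : R * R | `|fg.1 - fg.2| < e].
have entV : entourage V by exists e.
have := fam_nbhs (set_val f) entV Bb.
exact: initial_continuous.
Qed.

Lemma strong_dual_cvg (G : set_system (strong_dual E)) (g : strong_dual E) :
  Filter G ->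
  (forall (B : set E) (e : R), vn_bounded B -> 0 < e ->
    \forall f \near G, forall x, B x -> `|dual_fun g x - dual_fun f x| < e) ->
  G --> g.
Proof.
move=> FG Gg A [_ [[U Uo <-] gU UA]].
apply: (filterS UA).
have : {family @vn_bounded R E, set_val @ G --> (set_val g : E -> R)}.
  apply/fam_cvgP => B Bb V /uniform_nbhs[W [entW WV]]; apply: (filterS WV).
  have [e /= e0 eW] := entW.
  have := Gg _ _ Bb e0; apply: filterS => f fB x Bx; apply: eW => /=.
  exact: fB.
apply.
exact: open_nbhs_nbhs.
Qed.

End dual.

Section localization_nbhs.
Context {R : realType} {X : tvsType R} {C : set (set X)}.

Lemma localization_nbhs (U : set (localization C)) (A : set X) (x : X) :
  C A -> nbhs (x : localization C) U ->
  A x -> exists2 W : set X, nbhs x W & W `&` A `<=` U.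
Proof.
move=> CA; rewrite nbhsE => -[V [Vo Vx] VU] Ax.
have [W [_ Wx WV WC]] := Vo x Vx; have [W' W'o WA] := WC _ CA.
exists W'; last by rewrite -WA => y [/WV/VU].
by apply: open_nbhs_nbhs; split => //; have [] : (W' `&` A) x by rewrite -WA.
Qed.

End localization_nbhs.

Section truncated_balls.
Context {R : realType} {X : tvsType R} {q : X -> R} {Xs : nat -> set X}.
Hypothesis q_seminorm : is_seminorm q.
Hypothesis Xs_subspace : forall k, GRing.submod_closed (mem (Xs k)).
Hypothesis Xs_nondecreasing : forall k l, (k <= l)%N -> Xs k `<=` Xs l.

Local Notation C := (truncated_ball Xs q).

Lemma subspace0 k : Xs k 0.
Proof. exact/set_mem/(Xs_subspace k).1. Qed.

Lemma subspaceP k a x y : Xs k x -> Xs k y -> Xs k (a *: x + y).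
Proof.
by move=> /mem_set xk /mem_set yk; exact/set_mem/((Xs_subspace k).2 a x y).
Qed.

Lemma subspaceZ k a x : Xs k x -> Xs k (a *: x).
Proof.
by move=> xk; rewrite -(addr0 (a *: x)); exact: subspaceP (subspace0 k).
Qed.

Lemma subspaceB k x y : Xs k x -> Xs k y -> Xs k (x - y).
Proof. by move=> xk yk; rewrite addrC -scaleN1r; exact: subspaceP. Qed.

Lemma truncated_ball0 k : C k 0.
Proof. by split; [exact: subspace0|rewrite /= seminorm0]. Qed.

Lemma truncated_ballS k l : (k <= l)%N -> C k `<=` C l.
Proof.
move=> kl x [xk qx]; split; first exact: Xs_nondecreasing xk.
by rewrite /= (le_trans qx)// ler_nat.
Qed.

Lemma truncated_ballZ k l a x :
  (k <= l)%N -> `|a| * k%:R <= l%:R -> C k x -> C l (a *: x).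
Proof.
move=> kl akl [xk qx]; split; first exact/subspaceZ/(Xs_nondecreasing kl).
by rewrite /= q_seminorm.2 (le_trans _ akl)// ler_wpM2l.
Qed.

Lemma truncated_ball_convex k : convex_set (C k).
Proof.
move=> x y t /set_mem[xk qx] /set_mem[yk qy]; apply/mem_set; split.
  exact/subspaceP/subspaceZ.
apply: (le_trans (seminorm_conv q_seminorm x y t)).
have t0 : 0 <= t%:num by [].
have t1 : t%:num <= 1 by [].
move: qx qy => /= qx qy; nra.
Qed.

Lemma localization_continuous (f : X -> R) : scalar f ->
    (forall k x (e : R), 0 < e ->
      C k x -> \forall y \near x, C k y -> `|f y - f x| < e) ->
  continuous (f : localization (range C) -> R).
Proof.
move=> flin fC x U /nbhs_ballP[e /= e0 eU]; rewrite nbhs_simpl nbhsE.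
exists [set y | `|f x - f y| < e]; last by move=> y; exact: eU.
split; last by rewrite /= subrr normr0.
move=> y fy; exists [set y | `|f x - f y| < e]; split => //.
  move=> a b t /set_mem /= fa /set_mem /= fb; apply/mem_set => /=.
  have -> : f (conv t a b) = t%:num * f a + (1 - t%:num) * f b.
    by rewrite flin scalar_formZ.
  have -> : f x - (t%:num * f a + (1 - t%:num) * f b) =
      t%:num * (f x - f a) + (1 - t%:num) * (f x - f b) by ring.
  rewrite (le_lt_trans (ler_normD _ _))// !normrM.
  rewrite (ger0_norm (_ : 0 <= t%:num))// (@ger0_norm _ (1 - _)) ?subr_ge0//.
  exact: convex_comb_lt.
move=> _ [k _ <-].
exists (interior [set z | C k z -> `|f x - f z| < e]).
  exact: open_interior.
apply/seteqP; split => z [/= fz Cz]; split => //; last first.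
  exact: (interior_subset fz).
have e'0 : 0 < e - `|f x - f z| by rewrite subr_gt0.
apply: filterS (fC _ _ _ e'0 Cz) => w + Cw => /(_ Cw).
have := ler_distD (f z) (f x) (f w); rewrite (distrC (f w)); lra.
Qed.

End truncated_balls.

Section bounded_sets.
Context {R : realType} {X : tvsType R} {J : Type} {p : J -> X -> R}.
Context {q : X -> R} {Xs : nat -> set X}.
Hypothesis Xhausdorff : hausdorff_space X.
Hypothesis p_seminorm : forall i, is_seminorm (p i).
Hypothesis p_filtering : filtering p.
Hypothesis p_generates : generated_by p.
Hypothesis q_seminorm : is_seminorm q.
Hypothesis Xs_subspace : forall k, GRing.submod_closed (mem (Xs k)).
Hypothesis Xs_nondecreasing : forall k l, (k <= l)%N -> Xs k `<=` Xs l.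

Local Notation C := (truncated_ball Xs q).
Local Notation Xloc := (localization (range C)).

Hypothesis C_compact : forall k, compact (C k).

Lemma compact_seminorm_bounded (K : set X) i :
  compact K -> exists M, forall x, K x -> p i x <= M.
Proof.
move=> /compact_near_coveringP/(_ R +oo%R (fun M x => p i x <= M)) cK.
have [] : \forall M \near +oo%R, K `<=` [set x | p i x <= M].
  apply: cK => x Kx.
  exists ([set y | p i (y - x) <= 1], [set M | p i x + 1 <= M]) => /=.
    split; first exact: (nbhs_seminorm_ball p_generates).
    exact/nbhs_pinfty_ge/num_real.
  move=> [y M] /= [yx xM].
  by have := (p_seminorm i).1 (y - x) x; rewrite subrK; lra.
move=> M [_ /(_ (M + 1))] H; exists (M + 1); apply: H; lra.
Qed.

Lemma truncated_ball_bounded k : vn_bounded (C k : set Xloc).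
Proof.
move=> U /(localization_nbhs (imageP _ I)) => /(_ k).
move=> /(_ (truncated_ball0 q_seminorm Xs_subspace k)) [W]
  /(nbhs0_seminormP p_generates p_filtering)[i [r [r0 rW]]] WU.
have [M CM] := compact_seminorm_bounded i (@C_compact k).
exists (Num.max 1 (M / r)); first by rewrite lt_max ltr01.
move=> t; rewrite gt_max => /andP[t1 Mrt] x Cx.
have t0 : 0 < t by lra.
exists (t^-1 *: x); last by rewrite scalerA divff ?scale1r ?gt_eqF.
apply: WU; split.
  apply: rW => /=; rewrite (p_seminorm i).2 gtr0_norm ?invr_gt0//.
  rewrite ler_pdivrMl//; move: Mrt; rewrite ltr_pdivrMr// => Mrt.
  by rewrite (le_trans (CM _ Cx))// ltW.
apply: (truncated_ballZ q_seminorm Xs_subspace Xs_nondecreasing _ _ Cx) => //.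
by rewrite gtr0_norm ?invr_gt0// ler_piMl// invf_le1// ltW.
Qed.

(* Thickening [C n.+1] so that it still misses [y n] gives open convex sets
   [W n]; all but finitely many of them contain a given [C k], so their
   intersection is a neighbourhood of 0 for the localization. *)
Lemma truncated_ball_avoid (y : nat -> X) : (forall n, ~ C n.+1 (y n)) ->
  exists2 U : set Xloc, nbhs 0 U & forall n, ~ U (y n).
Proof.
move=> yC.
have /choice[jr jrP] n : exists jr : J * R, 0 < jr.2 /\
    forall x, p jr.1 (x - y n) <= jr.2 -> ~ C n.+1 x.
  have : nbhs (y n) (~` C n.+1).
    apply: open_nbhs_nbhs; split; last exact: yC.
    exact/closed_openC/(compact_closed Xhausdorff)/C_compact.
  move=> /(nbhs_seminormP p_generates p_filtering)[i [r [r0 rC]]].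
  by exists (i, r).
pose W n := [set x | exists2 c, C n.+1 c & p (jr n).1 (x - c) < (jr n).2].
have CW n : C n.+1 `<=` W n.
  by move=> x Cx; exists x => //; rewrite subrr seminorm0// (jrP n).1.
have Wo n : open (W n).
  rewrite openE => x [c Cc xc].
  have d0 : 0 < ((jr n).2 - p (jr n).1 (x - c)) / 2 by lra.
  apply: (filterS _ (nbhs_seminorm_ball p_generates (jr n).1 x d0)).
  move=> z zx; exists c => //.
  have := (p_seminorm (jr n).1).1 (z - x) (x - c); rewrite addrA subrK; lra.
have Wc n : convex_set (W n).
  move=> a b t /set_mem[c Cc ac] /set_mem[d Cd bd]; apply/mem_set.
  exists (conv t (c : convex_lmodType X) d).
    by apply/set_mem/truncated_ball_convex => //; exact/mem_set.
  have -> : conv t a b - conv t (c : convex_lmodType X) d =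
            conv t (a - c : convex_lmodType X) (b - d).
    by rewrite /conv /= !scalerBr opprD addrACA.
  apply: (le_lt_trans (seminorm_conv (p_seminorm _) _ _ _)).
  exact: convex_comb_lt.
exists (\bigcap_n W n); last first.
  move=> n /(_ n I)[c Cc]; rewrite -(seminormN (p_seminorm _)) opprB => cy.
  by apply: (jrP n).2 Cc; exact: ltW.
apply: open_nbhs_nbhs; split; last first.
  by move=> n _; apply/CW/truncated_ball0.
move=> x Wx; exists (\bigcap_n W n); split => //.
  move=> a b t /set_mem aW /set_mem bW; apply/mem_set => n _.
  by apply/set_mem/Wc; apply/mem_set; [exact: aW|exact: bW].
move=> _ [k _ <-]; exists (\bigcap_(n < k) W n).
  by rewrite bigcap_mkord; elim/big_ind : _ => //; [exact: openT|exact: openI].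
apply/seteqP; split => z [Wz Cz]; split => //; first by move=> n _; exact: Wz.
move=> n _; have [nk|kn] := ltnP n k; first exact: Wz.
by apply: CW; apply: truncated_ballS Cz => //; exact: leqW.
Qed.

Lemma vn_bounded_truncated_ball (B : set Xloc) :
  vn_bounded B -> exists k, B `<=` C k.
Proof.
move=> Bb; apply: contrapT => /forallNP BC.
have /choice[y yP] n : exists y : X, B (n.+1%:R *: y) /\ ~ C n.+1 y.
  have /existsNP[x /not_implyP[Bx Cx]] := BC (n.+1 ^ 2)%N.
  exists (n.+1%:R^-1 *: x); split; first by rewrite scalerA divff ?scale1r.
  move=> Cnx; apply: Cx.
  have -> : x = n.+1%:R *: (n.+1%:R^-1 *: x) by rewrite scalerA divff ?scale1r.
  apply: (truncated_ballZ q_seminorm Xs_subspace Xs_nondecreasing _ _ Cnx).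
    by rewrite leq_pmulr.
  by rewrite ger0_norm// -natrM.
have [U U0 Uy] := truncated_ball_avoid (fun n => (yP n).2).
have [r r0 rU] := Bb _ U0.
pose n := Num.bound r.
have rn : r < n.+1%:R.
  by rewrite (lt_trans (archi_boundP (ltW r0)))// ltr_nat.
have [u Uu] := rU _ rn _ (yP n).1.
move=> /scalerI; rewrite pnatr_eq0 => /(_ isT) uy.
by apply: (Uy n); rewrite -uy.
Qed.

End bounded_sets.

Lemma ultra_cvg_compact (S : Type) (T : topologicalType) (G : set_system S)
    (K : set T) (f : S -> T) :
  UltraFilter G -> compact K -> (\forall s \near G, K (f s)) ->
  exists l : T, f @ G --> l.
Proof.
move=> UG Kc KG; have [l [Kl lG]] := Kc (f @ G) _ KG.
exists l => V Vl.
have [GV|GV] := in_ultra_setVsetC (f @^-1` V) UG; first exact: GV.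
by have [z [nVz Vz]] := lG (~` V) V GV Vl.
Qed.

Section equicontinuity.
Context {R : realType} {X : tvsType R} {J : Type} {p : J -> X -> R}.
Context {q : X -> R} {Xs : nat -> set X}.
Hypothesis p_seminorm : forall i, is_seminorm (p i).
Hypothesis p_filtering : filtering p.
Hypothesis p_generates : generated_by p.
Hypothesis q_seminorm : is_seminorm q.
Hypothesis Xs_subspace : forall k, GRing.submod_closed (mem (Xs k)).
Hypothesis Xs_nondecreasing : forall k l, (k <= l)%N -> Xs k `<=` Xs l.
Hypothesis Xs_union : \bigcup_k Xs k = setT.
Hypothesis C_compact : forall k, compact (truncated_ball Xs q k).

Local Notation C := (truncated_ball Xs q).

Definition dominated (k : nat) (e : R) (i : J) (theta : R) : set (X -> R) :=
  [set h | forall x, Xs k x -> `|h x| <= theta * p i x + e * q x].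

Definition uniformly_dominated (H : set (X -> R)) :=
  forall k (e : R), 0 < e ->
    exists i theta, 0 < theta /\ H `<=` dominated k e i theta.

Lemma uniformly_dominated_ceil (H : set (X -> R)) :
  (forall e : R, 0 < e ->
    exists i theta, 0 < theta /\ H `<=` dominated `|Num.ceil e^-1| e i theta) ->
  uniformly_dominated H.
Proof.
move=> HH k e e0; pose d := Num.min e k.+1%:R^-1.
have d0 : 0 < d by rewrite lt_min e0 invr_gt0 ltr0n.
have [i [theta [theta0 Hi]]] := HH _ d0.
exists i, theta; split => // h /Hi hd x xk.
have kd : (k <= `|Num.ceil d^-1|)%N.
  have dk : k%:R <= d^-1.
    rewrite (@le_trans _ _ k.+1%:R) ?ler_nat// -[leLHS]invrK.
    by rewrite lef_pV2 ?posrE ?invr_gt0 ?ltr0n// ge_min lexx orbT.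
  have c0 : 0 <= Num.ceil d^-1.
    by rewrite -(ler_int R) (le_trans _ (ceil_ge _))// invr_ge0 ltW.
  by rewrite -(ler_nat R) natr_absz ger0_norm// (le_trans dk)// ceil_ge.
apply: (le_trans (hd x (Xs_nondecreasing kd xk))).
by rewrite lerD2l ler_wpM2r ?seminorm_ge0// ge_min lexx.
Qed.

Lemma uniformly_dominated_equicontinuous (H : set (X -> R)) k x (e : R) :
  H `<=` [set h | scalar h] -> uniformly_dominated H -> 0 < e -> C k x ->
  \forall y \near x, C k y -> forall h, H h -> `|h y - h x| < e.
Proof.
move=> Hlin Hdom e0 [xk qx].
have k1 : 0 < k%:R + 1 :> R by rewrite ltr_wpDl.
have d0 : 0 < e / (4 * (k%:R + 1)) by rewrite divr_gt0// mulr_gt0.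
have [i [theta [theta0 Hi]]] := Hdom k _ d0.
have r0 : 0 < e / (4 * theta) by rewrite divr_gt0// mulr_gt0.
apply: (filterS _ (nbhs_seminorm_ball p_generates i x r0)) => y yx [yk qy] h Hh.
have -> : h y - h x = h (y - x).
  by rewrite [y - x]addrC -(scaleN1r x) (Hlin _ Hh); ring.
apply: (le_lt_trans (Hi _ Hh _ (subspaceB Xs_subspace yk xk))).
have qyx : q (y - x) <= 2 * (k%:R + 1).
  have := seminormB q_seminorm y x; move: qx qy => /=; lra.
have : e / (4 * (k%:R + 1)) * q (y - x) <=
       e / (4 * (k%:R + 1)) * (2 * (k%:R + 1)).
  by rewrite ler_pM2l.
have -> : e / (4 * (k%:R + 1)) * (2 * (k%:R + 1)) = e / 2.
  by field; rewrite gt_eqF.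
have : theta * p i (y - x) <= theta * (e / (4 * theta)) by rewrite ler_pM2l.
have -> : theta * (e / (4 * theta)) = e / 4 by field; rewrite gt_eqF.
lra.
Qed.

Lemma uniformly_dominated_continuous (h : X -> R) :
  scalar h -> uniformly_dominated [set h] ->
  continuous (h : localization (range C) -> R).
Proof.
move=> hlin hdom; apply: localization_continuous => // k x e e0 Cx.
have := uniformly_dominated_equicontinuous (H := [set h]) _ hdom e0 Cx.
move=> /(_ _)/wrap[]; first by move=> _ ->.
by apply: filterS => y + Cy => /(_ Cy _ erefl).
Qed.

Hypothesis Xhausdorff : hausdorff_space X.

Local Notation D := (strong_dual (localization (range C))).

Lemma uniformly_dominated_compact (F : set D) :
  closed F -> uniformly_dominated (dual_fun (E := _) @` F) -> compact F.
Proof.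
move=> Fclosed Fdom; rewrite compact_ultra => G UG GF.
have /choice[g gP] x : exists l : R, dual_fun f x @[f --> G] --> l.
  have [k _ xk] : (\bigcup_k Xs k) x by rewrite Xs_union.
  have [i [theta [_ Fi]]] := Fdom k 1 ltr01.
  pose M := theta * p i x + 1 * q x.
  apply: (ultra_cvg_compact UG (@segment_compact R (- M) M)).
  apply: filterS GF => f Ff.
  by rewrite /= in_itv /= -ler_norml; apply: Fi => //; exists f.
have g_scalar : scalar g.
  move=> a u v.
  apply: (cvg_unique (@Rhausdorff R) (gP _)) => /=.
  have -> : (fun f : D => dual_fun f (a *: u + v)) =
            (fun f => a * dual_fun f u + dual_fun f v).
    by apply/funext => f; exact: dual_fun_scalar.
  by apply: cvgD => //; apply: cvgMr.
have g_dom : uniformly_dominated [set g].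
  move=> k e e0; have [i [theta [theta0 Fi]]] := Fdom k e e0.
  exists i, theta; split => // _ -> x xk.
  apply: (cvgr_to_le (cvg_norm (gP x))).
  by apply: filterS GF => f Ff; apply: Fi => //; exists f.
have g_cont := uniformly_dominated_continuous g_scalar g_dom.
pose g' : D := exist _ g (mem_set (conj g_scalar g_cont)).
have Gg : G --> g'.
  apply: strong_dual_cvg => B e Bb e0.
  have [k BC] := vn_bounded_truncated_ball Xhausdorff p_seminorm p_filtering
    p_generates q_seminorm Xs_subspace Xs_nondecreasing C_compact Bb.
  have e30 : 0 < e / 3 by rewrite divr_gt0.
  have /compact_near_coveringP/near_covering_withinP := @C_compact k.
  move=> /(_ _ G (fun f x => `|g x - dual_fun f x| < e)) Ck.
  suff : \forall f \near G, C k `<=` [set x | `|g x - dual_fun f x| < e].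
    by apply: filterS => f Cf x Bx; apply: Cf; exact: BC.
  apply: Ck => x Cx.
  have Fnear := uniformly_dominated_equicontinuous
    (H := dual_fun (E := _) @` F) _ Fdom e30 Cx.
  have gnear := uniformly_dominated_equicontinuous
    (H := [set g]) _ g_dom e30 Cx.
  near=> y f => Cy.
  have Ff : F f by near: f.
  have fy : `|dual_fun f y - dual_fun f x| < e / 3.
    have : C k y ->
        forall h, (dual_fun (E := _) @` F) h -> `|h y - h x| < e / 3.
      by near: y; apply: Fnear => _ [f' _ <-]; exact: (@dual_fun_scalar _ _ f').
    by apply => //; exists f.
  have gy : `|g y - g x| < e / 3.
    have : C k y -> forall h, [set g] h -> `|h y - h x| < e / 3.
      by near: y; apply: gnear => _ ->.
    exact.
  have fgx : `|g x - dual_fun f x| < e / 3.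
    by near: f; move/cvgrPdist_lt : (gP x); apply.
  move: fy gy fgx; rewrite !ltr_norml => /andP[? ?] /andP[? ?] /andP[? ?].
  by apply/andP; split; lra.
exists g'; split => //.
exact: (@closed_cvg _ _ G _ id F Fclosed GF g' Gg).
Unshelve. all: by end_near. Qed.

Lemma compact_dominated (F : set D) k :
  (0 < k)%N -> compact F -> exists i theta, 0 < theta /\
    dual_fun (E := _) @` F `<=` dominated k k%:R^-1 i theta.
Proof.
move=> k0 /compact_near_coveringP Fc.
have Cb : vn_bounded (C k : set (localization (range C))).
  exact: (truncated_ball_bounded p_seminorm p_filtering p_generates q_seminorm
    Xs_subspace Xs_nondecreasing C_compact).
have : \forall x \near (0 : X), C k x -> forall f, F f -> `|dual_fun f x| <= 1.
  suff : \forall x \near (0 : X),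
      F `<=` [set f : D | C k x -> `|dual_fun f x| <= 1].
    by apply: filterS => x Fx Cx f /Fx; exact.
  apply: Fc => f Ff.
  have half0 : 0 < 1 / 2 :> R by rewrite divr_gt0.
  have /(localization_nbhs (imageP C I)) :
      nbhs (0 : localization (range C)) [set x | `|dual_fun f x| < 1 / 2].
    have /cvgrPdist_lt/(_ _ half0) :=
      @dual_fun_continuous _ _ f (0 : localization (range C)).
    apply: filterS => x /=.
    by rewrite (scalar_form0 (@dual_fun_scalar _ _ f)) sub0r normrN.
  move=> /(_ _ (truncated_ball0 q_seminorm Xs_subspace k))[W W0 Wf].
  near=> g x => Cx.
  have fx : `|dual_fun f x| < 1 / 2 by apply: Wf; split => //; near: x.
  have fg : `|dual_fun f x - dual_fun g x| < 1 / 2.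
    suff : forall x, C k x -> `|dual_fun f x - dual_fun g x| < 1 / 2 by exact.
    by near: g; exact: strong_dual_nbhs.
  move: fx fg; rewrite !ltr_norml ler_norml => /andP[? ?] /andP[? ?].
  by apply/andP; split; lra.
move=> /(nbhs0_seminormP p_generates p_filtering)[i [r [r0 rF]]].
exists i, r^-1; split; first by rewrite invr_gt0.
move=> _ [f Ff <-] x xk.
have bound (t : R) : 0 < t -> p i x <= r * t -> q x <= k%:R * t ->
    `|dual_fun f x| <= t.
  move=> t0 pt qt.
  have -> : x = t *: (t^-1 *: x) by rewrite scalerA divff ?scale1r ?gt_eqF.
  rewrite (scalar_formZ (@dual_fun_scalar _ _ f)) normrM gtr0_norm//.
  rewrite ler_piMr ?(ltW t0)//; apply: rF => //=.
    by rewrite (p_seminorm i).2 gtr0_norm ?invr_gt0// ler_pdivrMl// mulrC.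
  split; first exact: subspaceZ.
  by rewrite /= q_seminorm.2 gtr0_norm ?invr_gt0// ler_pdivrMl// mulrC.
apply/ler_addgt0Pr => d d0.
have k0' : 0 < k%:R :> R by rewrite ltr0n.
have rp : 0 <= r^-1 * p i x.
  by rewrite mulr_ge0 ?invr_ge0 ?(ltW r0) ?seminorm_ge0.
have kq : 0 <= k%:R^-1 * q x by rewrite mulr_ge0 ?invr_ge0 ?ler0n ?seminorm_ge0.
apply: bound; first lra.
  by rewrite -ler_pdivrMl//; lra.
by rewrite -ler_pdivrMl//; lra.
Unshelve. all: by end_near. Qed.

End equicontinuity.

Theorem theorem9p1 (R : realType) (X : tvsType R) (I : Type)
    (p : I -> X -> R) (q : X -> R) (Xs : nat -> set X)
    (Xhausdorff : hausdorff_space X)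
    (p_seminorm : forall i, is_seminorm (p i))
    (p_filtering : filtering p)
    (p_generates : generated_by p)
    (q_seminorm : is_seminorm q)
    (q_lsc : lower_semicontinuous (fun x => (q x)%:E))
    (Xs_subspace : forall k, GRing.submod_closed (mem (Xs k)))
    (Xs_closed : forall k, closed (Xs k))
    (Xs_nondecreasing : forall k l, (k <= l)%N -> Xs k `<=` Xs l)
    (Xs_union : \bigcup_k Xs k = setT)
    (Ck_compact : forall k, compact (truncated_ball Xs q k))
    (F : set (strong_dual (localization (range (truncated_ball Xs q)))))
    (F_closed : closed F) :
  compact F <->
  (forall eps : R, 0 < eps -> exists (i : I) (theta : R), 0 < theta /\
     forall x f, Xs `|Num.ceil eps^-1|%N x -> F f ->
       `|dual_fun f x| <= theta * p i x + eps * q x).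
Proof.
split=> [Fcompact eps eps0|Fbound]; last first.
  apply: (uniformly_dominated_compact (p := p)) => //.
  apply: uniformly_dominated_ceil => // e e0.
  have [i [theta [theta0 Fi]]] := Fbound e e0.
  by exists i, theta; split => // _ [f Ff <-] x xe; exact: Fi.
set k := `|Num.ceil eps^-1|%N.
have kR : k%:R = (Num.ceil eps^-1)%:~R :> R.
  by rewrite natr_absz ger0_norm// -(ler_int R) (le_trans _ (ceil_ge _))//
    invr_ge0 ltW.
have epsk : eps^-1 <= k%:R by rewrite kR ceil_ge.
have k0 : 0 < k%:R :> R by rewrite (lt_le_trans _ epsk)// invr_gt0.
have [//|i [theta [theta0 Fi]]] := compact_dominated p_seminorm p_filtering
  p_generates q_seminorm Xs_subspace Xs_nondecreasing Ck_compact (k := k) _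
  Fcompact.
  by rewrite ltr0n in k0.
exists i, theta; split => // x f xk Ff.
apply: (le_trans (Fi _ (imageP _ Ff) x xk)).
rewrite lerD2l ler_wpM2r ?seminorm_ge0//.
by rewrite -[leRHS]invrK lef_pV2 ?posrE ?invr_gt0.
Qed.
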